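(* Let $M$ be a saturated nonstandard model of the superstructure $\mathcal{S}$ over $\mathbf{R}$ and let $\varepsilon\in{}^*\mathbf{R}_M$ be a positive infinitesimal. Then the asymptotic space $\mathcal{H}_0=\mathcal{H}_{0,M}$ of the Lobachevsky plane is a homogeneous metric space, i.e. its group of isometries acts transitively on its points.
   Context: Models. Let $S_0=\mathbf{R}$ (treated as individuals), $S_{i+1}=S_i\cup\mathcal{P}(S_i)$ and $\mathcal{S}=\bigcup_{i}S_i$ (the superstructure). Consider bounded first-order formulas (every variable ranges over some entity, i.e. over some element of $\mathcal{S}\setminus S_0$) in the language with $=$, $\in$ and a constant for each element of $\mathcal{S}$. A nonstandard model $M$ of $\mathcal{S}$ is a structure containing $\mathcal{S}$ via an injection $x\mapsto{}^*x$, with relations extending $=$ and $\in$, in which exactly the bounded sentences true in $\mathcal{S}$ are true (transfer), and such that ${}^*\mathbf{R}$ is a proper extension of $\mathbf{R}$. A number $a\in{}^*\mathbf{R}$ is finite if $|a|<K$ for some $K\in\mathbf{R}$; its standard part $\operatorname{st}(a)\in\mathbf{R}$ is the unique real infinitely close to $a$. Saturation. A set $T$ of (bounded) formulas $R(x,c)$ with one free variable $x$ and parameters $c$ from $M$ is finitely satisfiable if for every finite subset of $T$ there is an $x\in M$ satisfying all formulas in this subset. $M$ is $\kappa$-saturated if for every finitely satisfiable $T$ with $|T|<\kappa$ there is an $x\in M$ satisfying all formulas of $T$. $M$ is saturated if it is $\kappa$-saturated for $\kappa$ equal to the cardinality of (the underlying set of) $M$. Asymptotic space. The Lobachevsky plane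 $\mathcal{H}=(H,d)$ (curvature $-1$) is described in polar coordinates $(\rho,\varphi)$, $\rho\ge0$ (the distance to the origin), $\varphi\in S^1$, by $\cosh d(x_1,x_2)=\cosh\rho_1\cosh\rho_2-\sinh\rho_1\sinh\rho_2\cos(\varphi_1-\varphi_2)$. Its nonstandard extension is $({}^*H,{}^*d)$. Let $Y=\{(\rho,\varphi)\in{}^*H:\varepsilon\rho\text{ is finite}\}$. The asymptotic space $\mathcal{H}_{0,M}$ is the metric space $Y/{\approx}$ with distance $\operatorname{st}(\varepsilon\cdot{}^*d(x,y))$, where $x\approx y$ iff $\varepsilon\cdot{}^*d(x,y)$ is infinitesimal. *)

(* Defs.v *)
From HB Require Import structures.
From mathcomp Require Import all_boot all_order all_algebra.
From mathcomp Require Import generic_quotient.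
From mathcomp Require Import all_classical all_reals all_analysis.

Set Implicit Arguments.
Unset Strict Implicit.
Unset Printing Implicit Defensive.

Import Order.TTheory GRing.Theory Num.Theory.

Local Open Scope classical_set_scope.
Local Open Scope quotient_scope.

(* Superstructure over a set X of individuals.  Since the S_i increase,
   S_(i+1) = S_i `|` P(S_i) is X together with P(S_i); [tower i] is S_i in this
   form.  The same object occurs in all levels from some point on, so the union
   of the S_i is the quotient of {i & tower i} by [same], which compares
   hereditarily across levels. *)
Section Superstructure.
Variable X : Type.

Fixpoint tower (n : nat) : Type :=
  if n is m.+1 then (X + set (tower m))%type else X.

Fixpoint same (m n : nat) : tower m -> tower n -> Prop :=
  match m, n return tower m -> tower n -> Prop with
  | 0, 0 => fun x y => x = y
  | 0, n'.+1 => fun x y => if y is inl s then x = s else False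
  | m'.+1, 0 => fun x y => if x is inl r then r = y else False
  | m'.+1, n'.+1 => fun x y =>
      match x, y with
      | inl r, inl s => r = s
      | inr A, inr B => (forall a, A a -> exists2 b, B b & @same m' n' a b) /\
                        (forall b, B b -> exists2 a, A a & @same m' n' a b)
      | _, _ => False
      end
  end.

Definition code : Type := {n : nat & tower n}.

Definition same_code (x y : {classic code}) : bool :=
  `[< same (projT2 x) (projT2 y) >].

Lemma same_refl n (x : tower n) : same x x.
Proof.
elim: n x => [//|n IH] [//|A] /=.
by split=> a Aa; exists a.
Qed.

Lemma same_sym m n (x : tower m) (y : tower n) : same x y -> same y x.
Proof.
elim: m n x y => [|m IH] [|n] /= x y //; first by case: y.
  by case: x.
case: x y => [r|A] [s|B] //= -[h1 h2]; split=> [b /h2|a /h1] [c ? /IH ?];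
  by exists c.
Qed.

Lemma same_trans m n p (x : tower m) (y : tower n) (z : tower p) :
  same x y -> same y z -> same x z.
Proof.
elim: m n p x y z => [|m IH] [|n] [|p] /= x y z; last first.
- case: x y z => [r|A] [s|B] [t|C] //=; first by move=> -> ->.
  move=> [h1 h2] [h3 h4]; split=> [a /h1[b /h3[c Cc bc] ab]|c /h4[b /h2[a Aa ab] bc]].
    by exists c => //; apply: IH ab bc.
  by exists a => //; apply: IH ab bc.
all: repeat match goal with
  | |- context [match ?u with inl _ => _ | inr _ => _ end] => destruct u
  end; by [|congruence].
Qed.

Lemma same_code_refl : reflexive same_code.
Proof. by move=> x; apply/asboolP; apply: same_refl. Qed.

Lemma same_code_sym : symmetric same_code.
Proof.
by move=> x y; apply/asboolP/asboolP; apply: same_sym.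
Qed.

Lemma same_code_trans : transitive same_code.
Proof.
move=> y x z /asboolP xy /asboolP yz; apply/asboolP; exact: same_trans xy yz.
Qed.

Canonical same_code_equiv :=
  EquivRel same_code same_code_refl same_code_sym same_code_trans.

Definition superstructure : Type := {eq_quot same_code_equiv}.

Definition of_tower (n : nat) (t : tower n) : superstructure :=
  \pi_({eq_quot same_code_equiv}) (existT tower n t : {classic code}).

Definition to_code (x : superstructure) : code :=
  repr (x : {eq_quot same_code_equiv}).

Definition mem_code (x y : code) : Prop :=
  match y with
  | existT 0 _ => False
  | existT n.+1 (inl _) => False
  | existT n.+1 (inr B) => exists2 b, B b & same (projT2 x) b
  end.

Definition smem (x y : superstructure) : Prop :=
  mem_code (to_code x) (to_code y).

(* S_ n *)
Definition stage (n : nat) : set superstructure := range (@of_tower n).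

Definition ind (r : X) : superstructure := @of_tower 0 r.

(* The element { x \in S_n | A x } of S_(n+1). *)
Definition sep (n : nat) (A : set superstructure) : superstructure :=
  @of_tower n.+1 (inr [set t | A (of_tower t)]).

Definition entity : Type := {E : superstructure | ~ stage 0 E}.

Definition entity_val (E : entity) : superstructure := sval E.

Lemma of_towerP m n (x : tower m) (y : tower n) :
  of_tower x = of_tower y <-> same x y.
Proof.
split=> [/eqmodP/asboolP //|xy]; apply/eqmodP; exact/asboolP.
Qed.

Lemma to_codeK x : of_tower (projT2 (to_code x)) = x.
Proof.
rewrite /of_tower; have -> : existT tower _ (projT2 (to_code x)) = to_code x.
  by case: (to_code x).
exact: reprK.
Qed.

Lemma in_stage x : exists n, stage n x.
Proof. by exists (projT1 (to_code x)), (projT2 (to_code x)); rewrite ?to_codeK. Qed.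

Lemma smem_ind x r : ~ smem x (ind r).
Proof.
move: (to_codeK (ind r)); rewrite /smem; case: (to_code (ind r)) => [[|n] t] /=;
  first by move=> _ [].
by case: t => [s _ []|B]; rewrite /ind => /of_towerP /=.
Qed.

Lemma smem_of_tower x n (B : set (tower n)) :
  smem x (@of_tower n.+1 (inr B)) <-> exists2 b, B b & x = of_tower b.
Proof.
rewrite /smem; set y := of_tower _; move: (to_codeK y).
case: (to_code y) => [[|m] t] /=; first by move=> /of_towerP /=.
case: t => [r|A] /of_towerP //= -[h1 h2].
split.
  move=> [a /h1[b Bb ab] xa]; exists b => //.
  rewrite -(to_codeK x); apply/of_towerP; exact: same_trans xa ab.
move=> [b /h2[a Aa ab] xb]; exists a => //.
apply: same_trans (same_sym ab); apply/of_towerP.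
by rewrite to_codeK.
Qed.

Lemma smem_sep n A x : smem x (sep n A) <-> stage n x /\ A x.
Proof.
rewrite /sep smem_of_tower; split=> [[t At ->]|[[t _ <-] Ax]]; last by exists t.
by split=> //; exists t.
Qed.

Lemma stage0 x : stage 0 x <-> exists r, x = ind r.
Proof. by split=> [[r _ <-]|[r ->]]; exists r. Qed.

Lemma stage_ind n r : stage n (ind r).
Proof.
case: n => [|n]; first by exists r.
by exists (inl r) => //; apply/of_towerP.
Qed.

Lemma sep_stage n A : stage n.+1 (sep n A).
Proof. by exists (inr [set t | A (of_tower t)]). Qed.

Lemma sep_not_stage0 n A : ~ stage 0 (sep n A).
Proof. by move=> [r _ /of_towerP /=]. Qed.

Lemma sup_ext x y : ~ stage 0 x -> ~ stage 0 y ->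
  (forall z, smem z x <-> smem z y) -> x = y.
Proof.
have ent z : ~ stage 0 z -> exists n (B : set (tower n)),
    z = @of_tower n.+1 (inr B).
  rewrite -(to_codeK z); case: (to_code z) => [[|n]] /=.
    by move=> t []; exists t.
  move=> [r|B] h; last by exists n, B.
  by case: h; exists r => //; apply/of_towerP.
move=> /ent[m [A ->]] /ent[n [B ->]] h.
apply/of_towerP; split=> [a Aa|b Bb].
  have /h/smem_of_tower[b Bb /of_towerP ab] : smem (of_tower a) (@of_tower m.+1 (inr A)).
    by apply/smem_of_tower; exists a.
  by exists b.
have /h/smem_of_tower[a Aa /of_towerP ba] : smem (of_tower b) (@of_tower n.+1 (inr B)).
  by apply/smem_of_tower; exists b.
by exists a => //; apply: same_sym.
Qed.

Lemma stage_sub n : stage n `<=` stage n.+1.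
Proof.
elim: n => [x /stage0[r ->]|n IH x [[r|A] _ <-]]; first exact: stage_ind.
  have -> : @of_tower n.+1 (inl r) = ind r by apply/of_towerP.
  exact: stage_ind.
have <- : sep n.+1 (smem^~ (@of_tower n.+1 (inr A))) = @of_tower n.+1 (inr A).
  apply: sup_ext; first exact: sep_not_stage0.
    by move=> [r _ /of_towerP /=].
  move=> z; rewrite smem_sep; split=> [[]//|zA]; split=> //.
  apply: IH; move/smem_of_tower: zA => [a _ ->].
  by exists a.
exact: sep_stage.
Qed.

(* S_(n+1) = S_n `|` P(S_n); by smem_sep and sup_ext, the elements [sep n A]
   are exactly the subsets of S_n. *)
Lemma stageS n : stage n.+1 = stage n `|` range (sep n).
Proof.
apply/seteqP; split=> x; last first.
  by case=> [/stage_sub//|[A _ <-]]; apply: sep_stage.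
move=> [[r|A] _ <-].
  left; have -> : @of_tower n.+1 (inl r) = ind r by apply/of_towerP.
  exact: stage_ind.
right; exists (smem^~ (@of_tower n.+1 (inr A))) => //.
apply: sup_ext; first exact: sep_not_stage0.
  by move=> [r _ /of_towerP /=].
move=> z; rewrite smem_sep; split=> [[]//|zA]; split=> //.
move/smem_of_tower: zA => [a _ ->].
by exists a.
Qed.

(* Kuratowski pairs; [level x] is some n with x in S_n. *)
Definition level (x : superstructure) : nat := projT1 (to_code x).

Definition upair (x y : superstructure) : superstructure :=
  sep (maxn (level x) (level y)) [set z | z = x \/ z = y].

Definition opair (x y : superstructure) : superstructure :=
  upair (upair x x) (upair x y).

Lemma stage_leq m n : m <= n -> stage m `<=` stage n.
Proof.
elim: n => [|n IH]; first by rewrite leqn0 => /eqP ->.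
by rewrite leq_eqVlt => /predU1P[->//|/IH h] x /h /stage_sub.
Qed.

Lemma stage_level x : stage (level x) x.
Proof. by exists (projT2 (to_code x)); rewrite ?to_codeK. Qed.

Lemma smem_upair x y z : smem z (upair x y) <-> z = x \/ z = y.
Proof.
rewrite smem_sep; split=> [[]//|zxy]; split=> //.
by case: zxy => ->; apply: stage_leq (stage_level _);
  rewrite (leq_maxl, leq_maxr).
Qed.

Lemma upair_stage n x y : stage n x -> stage n y -> stage n.+1 (upair x y).
Proof.
move=> nx ny.
suff -> : upair x y = sep n [set z | z = x \/ z = y] by apply: sep_stage.
apply: sup_ext; try exact: sep_not_stage0.
move=> z; rewrite smem_upair smem_sep /=; split=> [|[]//].
by move=> zxy; split=> //; case: zxy => ->.
Qed.

Lemma opair_stage n x y : stage n x -> stage n y -> stage n.+2 (opair x y).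
Proof. by move=> nx ny; do !apply: upair_stage. Qed.

End Superstructure.

(* Bounded formulas over the superstructure with constants in C and free
   variables in V.  Quantified variables range over an entity; the bound
   variable is [None] in the body and the others are shifted by [Some]. *)
Section Formulas.
Variables X C : Type.

Inductive term (V : Type) : Type :=
  | Var of V
  | Cst of C.

Inductive formula (V : Type) : Type :=
  | FEq of term V & term V
  | FMem of term V & term V
  | FNot of formula V
  | FAnd of formula V & formula V
  | FOr of formula V & formula V
  | FImp of formula V & formula V
  | FAll of entity X & formula (option V)
  | FEx of entity X & formula (option V).

End Formulas.

Record structure : Type := Structure {
  carrier :> Type ;
  eqr : carrier -> carrier -> Prop ;
  memr : carrier -> carrier -> Prop }.

Definition std (X : Type) : structure :=
  @Structure (superstructure X) eq (@smem X).

Section Satisfaction.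
Variables (X C : Type) (D : structure).
Variables (bound : superstructure X -> D) (cst : C -> D).

Definition eval (V : Type) (env : V -> D) (t : term C V) : D :=
  match t with Var x => env x | Cst c => cst c end.

Definition extend (V : Type) (env : V -> D) (d : D) : option V -> D :=
  fun x => if x is Some y then env y else d.

Fixpoint sat (V : Type) (env : V -> D) (phi : formula X C V) : Prop :=
  match phi with
  | FEq t u => eqr (eval env t) (eval env u)
  | FMem t u => memr (eval env t) (eval env u)
  | FNot p => ~ sat env p
  | FAnd p q => sat env p /\ sat env q
  | FOr p q => sat env p \/ sat env q
  | FImp p q => sat env p -> sat env q
  | FAll E p => forall d, memr d (bound (entity_val E)) -> sat (extend env d) p
  | FEx E p => exists2 d, memr d (bound (entity_val E)) & sat (extend env d) p
  end.

End Satisfaction.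

Definition Rset (X : Type) : superstructure X := sep 0 setT.

(* The equality of M is only a relation extending that of the superstructure;
   Leibniz equality is a special case. *)
Record nonstandard_model (R : realType) : Type := NonstandardModel {
  model :> structure ;
  star : superstructure R -> model ;
  star_inj : injective star ;
  star_eq : forall x y, eqr (star x) (star y) <-> x = y ;
  star_mem : forall x y, memr (star x) (star y) <-> smem x y ;
  transfer : forall phi : formula R (superstructure R) void,
    sat (D := std R) id id (@of_void _) phi <->
    sat (D := model) star star (@of_void _) phi ;
  proper_extension : exists2 a : model, memr a (star (Rset R)) &
    forall r : R, ~ eqr a (star (ind r)) }.

Section Saturation.
Variables (R : realType) (M : nonstandard_model R).

(* A bounded formula in one free variable, with parameters from M.  As every
   variable ranges over an entity, so does the free one: a formula comes with
   the range of its free variable. *)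
Definition formula1 : Type := (entity R * formula R M unit)%type.

Definition satisfies (x : M) (phi : formula1) : Prop :=
  memr x (star M (entity_val phi.1)) /\
  sat (D := M) (star M) id (fun=> x) phi.2.

Definition finitely_satisfiable (T : set formula1) : Prop :=
  forall F : set formula1, finite_set F -> F `<=` T ->
    exists x : M, forall phi, F phi -> satisfies x phi.

Definition kappa_saturated (K : Type) : Prop :=
  forall T : set formula1, finitely_satisfiable T ->
    (T #<= [set: K])%card /\ ~ ([set: K] #<= T)%card ->
    exists x : M, forall phi, T phi -> satisfies x phi.

Definition saturated : Prop := kappa_saturated M.

End Saturation.

Local Open Scope ring_scope.

Section StandardObjects.
Variable R : realType.

Local Notation S := (superstructure R).

(* Graphs of relations and operations on R, as sets of pairs and of triples
   ((a, b), c). *)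
Definition rel_graph (r : R -> R -> Prop) : S :=
  sep 2 [set t | exists a b, r a b /\ t = opair (ind a) (ind b)].

Definition op_graph (f : R -> R -> R) : S :=
  sep 4 [set t | exists a b,
                   t = opair (opair (ind a) (ind b)) (ind (f a b))].

Definition cosh (x : R) : R := (expR x + expR (- x)) / 2.
Definition sinh (x : R) : R := (expR x - expR (- x)) / 2.

(* The circle is represented by [0, 2 pi); the angle of the origin is set to 0
   so that every point of the plane has exactly one pair of coordinates. *)
Definition polar (rho phi : R) : Prop :=
  0 <= rho /\ 0 <= phi < 2 * pi /\ (rho = 0 -> phi = 0).

Definition hyp_point (rho phi : R) : S := opair (ind rho) (ind phi).

Definition hyp_plane : S :=
  sep 2 [set x | exists rho phi, polar rho phi /\ x = hyp_point rho phi].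

Definition is_hyp_dist (rho1 phi1 rho2 phi2 delta : R) : Prop :=
  0 <= delta /\
  cosh delta = cosh rho1 * cosh rho2 -
               sinh rho1 * sinh rho2 * cos (phi1 - phi2).

Definition hyp_dist_graph : S :=
  sep 6 [set t | exists rho1 phi1 rho2 phi2 delta,
    polar rho1 phi1 /\ polar rho2 phi2 /\
    is_hyp_dist rho1 phi1 rho2 phi2 delta /\
    t = opair (opair (hyp_point rho1 phi1) (hyp_point rho2 phi2)) (ind delta)].

End StandardObjects.

(* Kuratowski pairs inside a structure, with all sets taken among the members
   of E. *)
Section Pairing.
Variables (D : structure) (E : D).

Definition is_upair (p x y : D) : Prop :=
  memr p E /\ forall z, memr z E -> (memr z p <-> eqr z x \/ eqr z y).

Definition is_opair (p x y : D) : Prop :=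
  exists a b, is_upair a x x /\ is_upair b x y /\ is_upair p a b.

End Pairing.

Section Nonstandard.
Variables (R : realType) (M : nonstandard_model R).

Definition starR (a : M) : Prop := memr a (star M (Rset R)).

(* S_6 contains every point, pair and triple used below. *)
Definition pairing : M -> M -> M -> Prop :=
  is_opair (star M (sep 6 setT)).

Definition real (r : R) : M := star M (ind r).

Definition rel_ext (G : superstructure R) (a b : M) : Prop :=
  exists2 p, memr p (star M G) & pairing p a b.

(* Extensions of standard functions with values in R, given by their graphs. *)
Definition fun1_ext (G : superstructure R) (a : M) : M :=
  xget (real 0 : {classic M}) [set c | starR c /\ rel_ext G a c].

Definition fun2_ext (G : superstructure R) (a b : M) : M :=
  xget (real 0 : {classic M})
    [set c | starR c /\ exists2 p, pairing p a b & rel_ext G p c].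

Definition mulM : M -> M -> M := fun2_ext (op_graph (fun a b : R => a * b)).
Definition subM : M -> M -> M := fun2_ext (op_graph (fun a b : R => a - b)).
Definition absM : M -> M := fun1_ext (rel_graph (fun a b : R => b = `|a|)).
Definition ltM : M -> M -> Prop := rel_ext (rel_graph (fun a b : R => a < b)).
Definition hdistM : M -> M -> M := fun2_ext (hyp_dist_graph R).

Definition finite_number (a : M) : Prop :=
  starR a /\ exists K : R, ltM (absM a) (real K).

Definition infinitesimal (a : M) : Prop :=
  starR a /\ forall K : R, 0 < K -> ltM (absM a) (real K).

Definition pos_infinitesimal (a : M) : Prop :=
  infinitesimal a /\ ltM (real 0) a.

Definition st (a : M) : R := xget 0 [set r | infinitesimal (subM a (real r))].

Section Asymptotic.
Variable eps : M.

Definition scaled_dist (x y : M) : M := mulM eps (hdistM x y).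

Definition finite_part : set M :=
  [set x | memr x (star M (hyp_plane R)) /\
           exists rho phi, [/\ starR rho, starR phi, pairing x rho phi &
                               finite_number (mulM eps rho)]].

Definition inf_near (x y : M) : Prop := infinitesimal (scaled_dist x y).

(* finite_part modulo inf_near, as the type of equivalence classes. *)
Definition asymptotic_space : Type :=
  {P : set M | exists2 x, finite_part x & P = [set y | finite_part y /\ inf_near x y]}.

Definition asymptotic_dist (P Q : asymptotic_space) : R :=
  xget 0 [set r | exists x y, [/\ sval P x, sval Q y & r = st (scaled_dist x y)]].

End Asymptotic.
End Nonstandard.

Record is_metric (R : realType) (T : Type) (d : T -> T -> R) : Prop := IsMetric {
  metric_ge0 : forall x y, 0 <= d x y ;
  metric_eq0 : forall x y, d x y = 0 <-> x = y ;
  metric_sym : forall x y, d x y = d y x ;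
  metric_triangle : forall x y z, d x z <= d x y + d y z }.

Definition is_isometry (R : realType) (T : Type) (d : T -> T -> R) (f : T -> T) : Prop :=
  bijective f /\ forall x y, d (f x) (f y) = d x y.

Definition homogeneous_metric_space (R : realType) (T : Type) (d : T -> T -> R) : Prop :=
  is_metric d /\ forall x y : T, exists2 f, is_isometry d f & f x = y.

(* Main.v *)
Require Import Defs.
From mathcomp Require Import all_boot all_order all_algebra.
From mathcomp Require Import all_classical all_reals all_analysis.
From mathcomp Require Import ring lra.

(* By transfer, every internal isometry of *H that moves x to y preserves the
   finite part when x and y lie in it, and so induces an isometry of the
   asymptotic space.  The isometry used is the half-turn about the midpoint of
   x and y in the hyperboloid model,
     v |-> <v, x + y> / (1 + <x, y>) (x + y) - v,
   whose graph is an element of S_5.  Every standard part st (eps d(x, y)) is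
   determined by the standard q such that eps d(x, y) < q, so only this relation
   between x, y and q has to be transferred to get the metric axioms. *)

Set Implicit Arguments.
Unset Strict Implicit.
Unset Printing Implicit Defensive.

Import Order.TTheory GRing.Theory Num.Theory.

Local Open Scope classical_set_scope.
Local Open Scope ring_scope.

(** Any isometry moving x to y would serve. The half-turn is preferred because it is one rational
    formula in x and y, valid also for x = y since 1 + <x, y> >= 2, and because an involution is
    surjective at no extra cost. Vectors are only a computing device over R: the points in the
    superstructure are pairs of polar coordinates, and [vec] translates between the two. No algebra
    is developed on *R, whose equality is merely the relation [eqr]. Each fact about it is one
    bounded sentence verified on real numbers, in which a sum such as q + s of standard bounds is
    already a single constant. The map on classes is obtained by choice from a relation; it is well
    behaved because classes at distance 0 coincide. *)

(** * Stages and Kuratowski pairs in the superstructure *)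

Section Superstructure.
Variable X : Type.
Implicit Types x y z p : superstructure X.

Lemma ind_inj : injective (@ind X).
Proof. by move=> r s h; exact: (of_towerP _ _).1 h. Qed.

Lemma smem_Rset x : smem x (Rset X) <-> exists r, x = ind r.
Proof. by rewrite smem_sep -stage0; split=> [[]|]. Qed.

Lemma smem_stage n x z : stage n.+1 x -> smem z x -> stage n z.
Proof.
move=> [[r|B] _ <-].
  have -> : @of_tower X n.+1 (inl r) = ind r by apply/of_towerP.
  by move=> h; case: (smem_ind h).
by move=> /smem_of_tower[b _ ->]; exists b.
Qed.

Lemma upair_inj x y z p : upair x y = upair z p ->
  (x = z /\ y = p) \/ (x = p /\ y = z).
Proof.
move=> e.
have h w : w = x \/ w = y <-> w = z \/ w = p by rewrite -!smem_upair e.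
move: (h x).1 (h y).1 (h z).2 (h p).2.
move=> /(_ (or_introl erefl)) hx /(_ (or_intror erefl)) hy.
move=> /(_ (or_introl erefl)) hz /(_ (or_intror erefl)) hp.
by intuition congruence.
Qed.

Lemma opair_inj x y z p : opair x y = opair z p -> x = z /\ y = p.
Proof.
move=> /upair_inj[[/upair_inj e1 /upair_inj e2]|[/upair_inj e1 /upair_inj e2]];
 by intuition congruence.
Qed.

Definition S6 : superstructure X := sep 6 setT.

(** [is_upair] sees only the members of S_6. Since p is in S_6, all its members are visible and
    extensionality applies; x and y are taken in S_5 so that their pair is in S_6. *)
Lemma is_upairE p x y : stage 5 x -> stage 5 y ->
  @is_upair (std X) S6 p x y <-> p = upair x y.
Proof.
move=> sx sy; rewrite /is_upair /= smem_sep; split=> [[[p6 _] h]|->].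
  have hz z : smem z p <-> z = x \/ z = y.
    split=> [zp|zxy].
      apply/h => //; apply/smem_sep; split=> //.
      exact: stage_sub (smem_stage p6 zp).
    by apply/h => //; apply/smem_sep; split=> //; case: zxy => ->;
      exact: stage_sub.
  apply: sup_ext; last by move=> z; rewrite smem_upair hz.
    move=> /stage0[r pE]; have : smem x p by apply/hz; left.
    by rewrite pE => h1; case: (smem_ind h1).
  exact: sep_not_stage0.
split=> [|z _]; last exact: smem_upair.
by split=> //; exact: upair_stage.
Qed.

(** An ordered pair has two layers of unordered pairs, and each costs one stage: hence 4 in place of
    5. *)
Lemma is_opairE p x y : stage 4 x -> stage 4 y ->
  @is_opair (std X) S6 p x y <-> p = opair x y.
Proof.
move=> sx sy; have [sx5 sy5] := (stage_sub sx, stage_sub sy).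
split=> [[a [b [/is_upairE-> // [/is_upairE-> // h]]]]|->].
  by move: h => /is_upairE; apply; exact: upair_stage.
exists (upair x x), (upair x y).
by split; [|split]; apply/is_upairE => //; exact: upair_stage.
Qed.

End Superstructure.

(** * Bounded formulas for the relations, and their meaning in a structure *)

(* D is either the superstructure or M, and [b] interprets the standard elements;
   for M the relations below unfold to the ones of Defs. *)
Section Relations.
Variables (R : realType) (D : structure) (b : superstructure R -> D).

Definition pairD : D -> D -> D -> Prop := is_opair (b (S6 R)).

Definition relD (G : superstructure R) (x y : D) : Prop :=
  exists2 p, memr p (b G) & pairD p x y.

Definition opD (G : superstructure R) (x y z : D) : Prop :=
  exists2 p, pairD p x y & relD G p z.

(** Quantifiers are bounded by standard entities only, so p cannot range over the variable g; it
    ranges over S_6, and membership in g is a conjunct. *)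
Definition inD (g x y : D) : Prop :=
  exists2 p, memr p (b (S6 R)) & memr p g /\ pairD p x y.

Definition lt_graph : superstructure R := rel_graph (fun x y : R => x < y).
Definition abs_graph : superstructure R := rel_graph (fun x y : R => y = `|x|).

(* e d(x, y) < q *)
Definition nearD (e x y q : D) : Prop :=
  exists2 d, memr d (b (Rset R)) & opD (hyp_dist_graph R) x y d /\
  exists2 m, memr m (b (Rset R)) & opD (op_graph *%R) e d m /\ relD lt_graph m q.

Local Notation formula := (formula R (superstructure R)).
Local Notation term := (term (superstructure R)).

Definition lift V (t : term V) : term (option V) :=
  match t with Var x => Var _ (Some x) | Cst c => Cst _ c end.

Definition ent n (A : set (superstructure R)) : entity R :=
  exist _ (sep n A) (@sep_not_stage0 R n A).

Definition entS6 : entity R := ent 6 setT.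
Definition entR : entity R := ent 0 setT.

Local Notation v0 := (Var _ None).
Local Notation v1 := (Var _ (Some None)).

Definition fiff V (p q : formula V) : formula V := FAnd (FImp p q) (FImp q p).

Definition fupair V (p x y : term V) : formula V :=
  FAnd (FMem R p (Cst V (S6 R)))
       (FAll entS6 (fiff (FMem R v0 (lift p))
                      (FOr (FEq R v0 (lift x)) (FEq R v0 (lift y))))).

Definition fopair V (p x y : term V) : formula V :=
  FEx entS6 (FEx entS6 (FAnd (fupair v1 (lift (lift x)) (lift (lift x)))
    (FAnd (fupair v0 (lift (lift x)) (lift (lift y)))
          (fupair (lift (lift p)) v1 v0)))).

Definition frelD V (G : entity R) (x y : term V) : formula V :=
  FEx G (fopair v0 (lift x) (lift y)).

Definition fop V (G : entity R) (x y z : term V) : formula V :=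
  FEx entS6 (FAnd (fopair v0 (lift x) (lift y)) (frelD G v0 (lift z))).

Definition fin V (g x y : term V) : formula V :=
  FEx entS6 (FAnd (FMem R v0 (lift g)) (fopair v0 (lift x) (lift y))).

Definition entLt : entity R := exist _ lt_graph (@sep_not_stage0 _ _ _).
Definition entOp f : entity R := exist _ (op_graph f) (@sep_not_stage0 _ _ _).
Definition entAbs : entity R := exist _ abs_graph (@sep_not_stage0 _ _ _).
Definition entH : entity R := exist _ (hyp_plane R) (@sep_not_stage0 _ _ _).
Definition entDist : entity R := exist _ (hyp_dist_graph R) (@sep_not_stage0 _ _ _).

Definition fnear V (e x y q : term V) : formula V :=
  FEx entR (FAnd (fop entDist (lift x) (lift y) v0)
    (FEx entR (FAnd (fop (entOp *%R) (lift (lift e)) v1 v0)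
                  (frelD entLt v0 (lift (lift q)))))).

Lemma eval_lift V (env : V -> D) d (t : term V) :
  Defs.eval b (extend env d) (lift t) = Defs.eval b env t.
Proof. by case: t. Qed.

Local Notation sat := (Defs.sat b b).

(** Rewriting with it unfolds one connective and leaves the subformulas folded for the other [sat_]
    lemmas. *)
Lemma satEx V (env : V -> D) G p : sat env (FEx G p) =
  exists2 d, memr d (b (entity_val G)) & sat (extend env d) p.
Proof. by []. Qed.

Lemma satAnd V (env : V -> D) p q :
  sat env (FAnd p q) = (sat env p /\ sat env q).
Proof. by []. Qed.

Lemma sat_upair V (env : V -> D) p x y :
  sat env (fupair p x y) <->
  is_upair (b (S6 R)) (Defs.eval b env p) (Defs.eval b env x) (Defs.eval b env y).
Proof. by split=> -[h1 h2]; split=> // z /h2 /=; rewrite !eval_lift. Qed.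

Lemma sat_opair V (env : V -> D) p x y :
  sat env (fopair p x y) = pairD (Defs.eval b env p) (Defs.eval b env x) (Defs.eval b env y).
Proof.
apply/propext; split=> [[a _ [c _ [/sat_upair h1 [/sat_upair h2 /sat_upair h3]]]]|].
  by exists a, c; move: h1 h2 h3; rewrite !eval_lift.
(* [is_opair] quantifies over all of D; the bound that [FEx] asks for is the first half of
   [is_upair]. *)
move=> [a [c [h1 [h2 h3]]]]; have [[a6 _] [c6 _]] := (h1, h2).
exists a => //; exists c => //.
by split; [|split]; apply/sat_upair; rewrite !eval_lift.
Qed.

Lemma sat_rel V (env : V -> D) G x y :
  sat env (frelD G x y) = relD (entity_val G) (Defs.eval b env x) (Defs.eval b env y).
Proof.
apply/propext; rewrite satEx; split=> -[p pG] h; exists p => //; move: h;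
  by rewrite sat_opair !eval_lift.
Qed.

Lemma sat_op V (env : V -> D) G x y z :
  sat env (fop G x y z) =
  opD (entity_val G) (Defs.eval b env x) (Defs.eval b env y) (Defs.eval b env z).
Proof.
apply/propext; rewrite satEx; split=> -[p p6].
  by rewrite satAnd sat_opair sat_rel !eval_lift => -[h1 h2]; exists p.
have [? [? [? [? [h _]]]]] := p6.
by exists p => //; rewrite satAnd sat_opair sat_rel !eval_lift.
Qed.

Lemma sat_near V (env : V -> D) e x y q :
  sat env (fnear e x y q) = nearD (Defs.eval b env e) (Defs.eval b env x)
    (Defs.eval b env y) (Defs.eval b env q).
Proof.
apply/propext; rewrite satEx; split=> -[d dR].
  rewrite satAnd satEx sat_op !eval_lift => -[hd [m mR]].
  by rewrite satAnd sat_op sat_rel /= !eval_lift => h; exists d => //; split=> //; exists m.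
move=> [hd [m mR h]]; exists d => //.
rewrite satAnd satEx sat_op !eval_lift; split=> //; exists m => //.
by rewrite satAnd sat_op sat_rel /= !eval_lift.
Qed.

Lemma sat_in V (env : V -> D) g x y :
  sat env (fin g x y) = inD (Defs.eval b env g) (Defs.eval b env x) (Defs.eval b env y).
Proof.
apply/propext; rewrite satEx; split=> -[p p6] h; exists p => //; move: h;
  by rewrite satAnd sat_opair !eval_lift /= eval_lift.
Qed.

End Relations.

(** * The hyperboloid model over the real numbers *)

Section Hyperboloid.
Variable R : realType.
Implicit Types (a b c t : R) (x y z v w : R * R * R).

Lemma cosh2Bsinh2 t : cosh t * cosh t - sinh t * sinh t = 1.
Proof. by rewrite /cosh /sinh; have := expRxMexpNx_1 t; lra. Qed.

Lemma coshD s t : cosh (s + t) = cosh s * cosh t + sinh s * sinh t.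
Proof. by rewrite /cosh /sinh opprD !expRD; field. Qed.

Lemma cosh0 : cosh 0 = 1 :> R.
Proof. by rewrite /cosh oppr0 expR0; field. Qed.

Lemma sinh0 : sinh 0 = 0 :> R.
Proof. by rewrite /sinh oppr0 expR0; field. Qed.

Lemma sinh_ge0 t : 0 <= t -> 0 <= sinh t.
Proof.
by move=> t0; rewrite /sinh divr_ge0 // subr_ge0 ler_expR; lra.
Qed.

Lemma cosh_gt0 t : 0 < cosh t.
Proof. by rewrite /cosh divr_gt0 // addr_gt0 ?expR_gt0. Qed.

Lemma cosh_lt s t : 0 <= s -> s < t -> cosh s < cosh t.
Proof.
move=> s0 st; have u1 : 1 <= expR s by rewrite -expR0 ler_expR.
have uv : expR s < expR t by rewrite ltr_expR.
rewrite /cosh !expRN ltr_pM2r ?invr_gt0 //.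
set u := expR s in u1 uv *; set v := expR t in uv *.
rewrite -subr_gt0.
have -> : v + v^-1 - (u + u^-1) = (v - u) * (u * v - 1) / (u * v).
  by field; apply/andP; split; apply: lt0r_neq0; lra.
by rewrite divr_gt0 ?mulr_gt0 //; nra.
Qed.

Lemma cosh_inj s t : 0 <= s -> 0 <= t -> cosh s = cosh t -> s = t.
Proof.
move=> s0 t0 e; case: (ltgtP s t) => // [/(cosh_lt s0)|/(cosh_lt t0)];
  by rewrite e ltxx.
Qed.

Lemma cosh_le s t : 0 <= s -> 0 <= t -> cosh s <= cosh t -> s <= t.
Proof. by move=> s0 t0; case: (leP s t) => // /(cosh_lt t0); lra. Qed.

(** As cosh t + sinh t = exp t, the only candidate is t = ln (a + b); then exp (- t) = a - b because
    (a + b)(a - b) = 1. *)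
Lemma cosh_sinh_surj a b : 0 < a -> 0 <= b -> a * a - b * b = 1 ->
  exists2 t, 0 <= t & cosh t = a /\ sinh t = b.
Proof.
move=> a0 b0 e; have ab : 0 < a + b by lra.
have ab1 : 1 <= a + b by nra.
exists (ln (a + b)); first exact: ln_ge0.
have ei : (a + b)^-1 = a - b.
  by apply: (mulfI (lt0r_neq0 ab)); rewrite divff ?lt0r_neq0 //; lra.
by rewrite /cosh /sinh expRN lnK ?posrE // ei; split; field.
Qed.

Lemma angle_surj a b : a * a + b * b = 1 ->
  exists2 t, 0 <= t < 2 * pi & cos t = a /\ sin t = b.
Proof.
move=> e; have pi0 := pi_gt0 R.
have a1 : -1 <= a <= 1 by apply/andP; split; nra.
have ac : cos (acos a) = a by rewrite acosK // in_itv /= a1.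
have sa : sin (acos a) = `|b|.
  by rewrite sin_acos // -sqrtr_sqr; congr Num.sqrt; rewrite !expr2; lra.
have [g0 gp] := (acos_ge0 a1, acos_lepi a1).
have [b0|b0] := leP 0 b.
  exists (acos a); first by apply/andP; split; lra.
  by rewrite ac sa ger0_norm.
(* b < 0 excludes a = 1, so acos a > 0 and 2 pi - acos a stays strictly below 2 pi. *)
have a1' : -1 <= a < 1 by apply/andP; split; nra.
have gp' := acos_gt0 a1'.
exists (2 * pi - acos a); first by apply/andP; split; lra.
have -> : 2 * pi - acos a = - acos a + pi *+ 2 by rewrite -mulr_natl; ring.
by rewrite cosD2pi sinD2pi cosN sinN ac sa ltr0_norm // opprK.
Qed.

(** The Minkowski form of signature (1, 2). *)
Definition mform v w : R := v.1.1 * w.1.1 - v.1.2 * w.1.2 - v.2 * w.2.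

Definition on_sheet v : Prop := 0 < v.1.1 /\ mform v v = 1.

Lemma mformC v w : mform v w = mform w v.
Proof. by rewrite /mform; ring. Qed.

(** The reversed Cauchy-Schwarz inequality. The squares of the first coordinates are the norms of
    (1, b, c) and (1, t, u), so the ordinary inequality applies; the sum of three squares below is
    Lagrange's identity. *)
Lemma mform_ge1 v w : on_sheet v -> on_sheet w -> 1 <= mform v w.
Proof.
case: v => [[a b] c]; case: w => [[s t] u].
rewrite /on_sheet /mform /= => -[a0 ea] [s0 es].
have h : (1 + (b * t + c * u)) ^+ 2 <= (a * s) ^+ 2.
  have -> : (a * s) ^+ 2 = (1 + b * b + c * c) * (1 + t * t + u * u).
    by rewrite (_ : (a * s) ^+ 2 = (a * a) * (s * s)); [congr (_ * _); lra|ring].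
  rewrite -subr_ge0.
  suff -> : (1 + b * b + c * c) * (1 + t * t + u * u) - (1 + (b * t + c * u)) ^+ 2
    = (b - t) ^+ 2 + (c - u) ^+ 2 + (b * u - c * t) ^+ 2.
    by rewrite !addr_ge0 ?sqr_ge0.
  by ring.
have as0 : 0 <= a * s by rewrite mulr_ge0 ?ltW.
suff : 1 + (b * t + c * u) <= a * s by lra.
have [k0|k0] := leP 0 (1 + (b * t + c * u)); last lra.
by rewrite -(ler_pXn2r (n := 2)) ?nnegrE.
Qed.

(** If w were on the lower sheet, -w would be on the upper one and its product with v at least 1,
    against the sign of <w, v>; a zero first coordinate would give <w, w> <= 0. *)
Lemma on_sheetP v w : on_sheet v -> mform w w = 1 -> 0 < mform w v ->
  on_sheet w.
Proof.
move=> sv ww wv; split=> //; case: (ltgtP 0 w.1.1) => // w0.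
  have : on_sheet (- w.1.1, - w.1.2, - w.2).
    by split; [move: w0 => /=; lra|rewrite -ww /mform /=; ring].
  by move=> /mform_ge1 /(_ sv); move: wv; rewrite /mform /=; lra.
by move: ww; rewrite /mform -w0; nra.
Qed.

(* The half-turn about the midpoint of x and y. *)
Definition half_turn x y v : R * R * R :=
  let k := (mform v x + mform v y) / (1 + mform x y) in
  (k * (x.1.1 + y.1.1) - v.1.1, k * (x.1.2 + y.1.2) - v.1.2,
   k * (x.2 + y.2) - v.2).

Section HalfTurn.
Variables x y : R * R * R.
Hypotheses (xS : on_sheet x) (yS : on_sheet y).

Let nz : 1 + mform x y != 0.
Proof. by have := mform_ge1 xS yS => h; apply: lt0r_neq0; lra. Qed.

(** As <x + y, x + y> = 2 (1 + <x, y>), the vector k (x + y) is twice the orthogonal projection of v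
    to the axis x + y. The map is thus the identity on the axis and minus the identity on its
    orthogonal complement. *)
Lemma half_turn_form v w :
  mform (half_turn x y v) (half_turn x y w) = mform v w.
Proof.
rewrite /half_turn; set k := _ / _; set l := _ / _.
have ek : k * (1 + mform x y) = mform v x + mform v y by rewrite mulfVK.
have el : l * (1 + mform x y) = mform w x + mform w y by rewrite mulfVK.
transitivity (k * l * (mform x x + mform y y + 2 * mform x y)
  - k * (mform w x + mform w y) - l * (mform v x + mform v y) + mform v w).
  by rewrite /mform /=; ring.
by rewrite (proj2 xS) (proj2 yS) -ek -el; ring.
Qed.

Lemma half_turn_swap : half_turn x y x = y.
Proof.
rewrite /half_turn (proj2 xS) divff // !mul1r.
by case: x y => [[? ?] ?] [[? ?] ?] /=; congr (_, _, _); ring.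
Qed.

(** The axis is fixed, so v and its image have the same product with x + y, hence the same
    coefficient k. *)
Lemma half_turnK v : half_turn x y (half_turn x y v) = v.
Proof.
rewrite {1}/half_turn; set u := half_turn x y v.
suff -> : mform u x + mform u y = mform v x + mform v y.
  by rewrite /u /half_turn /=; case: v {u} => [[? ?] ?] /=; congr (_, _, _); ring.
rewrite /u /half_turn; set k := _ / _.
have ek : k * (1 + mform x y) = mform v x + mform v y by rewrite mulfVK.
transitivity (k * (mform x x + mform y y + 2 * mform x y)
  - (mform v x + mform v y)); first by rewrite /mform /=; ring.
by rewrite (proj2 xS) (proj2 yS) -ek; ring.
Qed.

(** With T the half-turn, <T v, y> = <T v, T x> = <v, x> >= 1, which decides the sheet without
    computing the sign of a coordinate. *)
Lemma half_turn_sheet v : on_sheet v -> on_sheet (half_turn x y v).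
Proof.
move=> vS; apply: (on_sheetP yS); first by rewrite half_turn_form (proj2 vS).
rewrite -{2}half_turn_swap half_turn_form.
by have := mform_ge1 vS xS; lra.
Qed.

End HalfTurn.

(* Half-turning y to the vertex (1, 0, 0) reduces to the addition formula for
   cosh and the Cauchy-Schwarz inequality. *)
Lemma sheet_triangle x y z s t r : on_sheet x -> on_sheet y -> on_sheet z ->
  0 <= s -> 0 <= t -> 0 <= r ->
  cosh s = mform x y -> cosh t = mform y z -> cosh r = mform x z -> r <= s + t.
Proof.
move=> xS yS zS s0 t0 r0 es et er.
apply: cosh_le => //; first lra.
have oS : on_sheet (1, 0, 0) by split=> //; rewrite /mform /=; ring.
have F := half_turn_form yS oS; have sw := half_turn_swap yS oS.
rewrite coshD; move: es et er; rewrite -(F x y) -(F y z) -(F x z) sw.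
have := half_turn_sheet yS oS xS; have := half_turn_sheet yS oS zS.
case: (half_turn _ _ x) => [[a b] c]; case: (half_turn _ _ z) => [[d e] f].
rewrite /on_sheet /mform /= => -[_ ed] [_ ea] es et er.
have {}es : cosh s = a by rewrite es; ring.
have {}et : cosh t = d by rewrite et; ring.
have := cosh2Bsinh2 s; have := cosh2Bsinh2 t; rewrite er es et => h1 h2.
have ss := sinh_ge0 s0; have st := sinh_ge0 t0.
set p := sinh s in ss h2 *; set q := sinh t in st h1 *.
have : - (b * e + c * f) <= p * q.
  have pq0 : 0 <= p * q by rewrite mulr_ge0.
  have [k0|k0] := leP 0 (- (b * e + c * f)); last lra.
  rewrite -(ler_pXn2r (n := 2)) ?nnegrE //.
  have -> : (p * q) ^+ 2 = (b * b + c * c) * (e * e + f * f).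
    by rewrite (_ : (p * q) ^+ 2 = (p * p) * (q * q)); [congr (_ * _); lra|ring].
  rewrite -subr_ge0.
  suff -> : (b * b + c * c) * (e * e + f * f) - (- (b * e + c * f)) ^+ 2
    = (b * f - c * e) ^+ 2 by exact: sqr_ge0.
  by ring.
by lra.
Qed.

Definition vec (rho phi : R) : R * R * R :=
  (cosh rho, sinh rho * cos phi, sinh rho * sin phi).

Lemma vec_sheet rho phi : on_sheet (vec rho phi).
Proof.
split; rewrite /mform /= ?cosh_gt0 // -(cosh2Bsinh2 rho).
have := cos2Dsin2 phi; rewrite !expr2 => h.
transitivity (cosh rho * cosh rho - sinh rho * sinh rho *
  (cos phi * cos phi + sin phi * sin phi)); first by ring.
by rewrite h; ring.
Qed.

Lemma vec_surj v : on_sheet v -> exists rho phi, polar rho phi /\ vec rho phi = v.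
Proof.
case: v => [[a b] c]; rewrite /on_sheet /mform /= => -[a0 e].
have bc0 : 0 <= b ^+ 2 + c ^+ 2 by rewrite addr_ge0 ?sqr_ge0.
have rr := sqr_sqrtr bc0; have r0 := sqrtr_ge0 (b ^+ 2 + c ^+ 2).
move: rr r0; set r := Num.sqrt _; rewrite !expr2 => rr r0.
have ar : a * a - r * r = 1 by lra.
have [t t0 [ca sr]] := cosh_sinh_surj a0 r0 ar.
(* At the vertex the direction (b / r, c / r) is undefined, and [polar] prescribes the angle 0. *)
have [rz|rz] := eqVneq r 0.
  exists 0, 0; split.
    by split; [|split] => //; rewrite lexx mulr_gt0 ?pi_gt0.
  rewrite /vec cosh0 sinh0 !mul0r.
  have [b0 c0] : b = 0 /\ c = 0 by split; apply/eqP; rewrite -sqrf_eq0 expr2; apply/eqP; nra.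
  by congr (_, _, _) => //; subst; nra.
have r2 : r * r != 0 by rewrite mulf_neq0.
have [|phi hphi [cphi sphi]] := @angle_surj (b / r) (c / r).
  transitivity ((b * b + c * c) / (r * r)); first by field.
  by rewrite -rr divff.
exists t, phi; split.
  by split; [|split] => // tz; move: rz; rewrite -sr tz sinh0 eqxx.
by rewrite /vec ca sr cphi sphi; congr (_, _, _); field.
Qed.

(** By the subtraction formula for the cosine, the right-hand side of the hyperbolic law of cosines
    is the Minkowski product of the two vectors. *)
Lemma is_hyp_distE rho1 phi1 rho2 phi2 t :
  is_hyp_dist rho1 phi1 rho2 phi2 t <->
  0 <= t /\ cosh t = mform (vec rho1 phi1) (vec rho2 phi2).
Proof.
rewrite /is_hyp_dist cosB; set u := _ - _; set v := mform _ _.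
by have -> : u = v by rewrite /u /v /mform /=; ring.
Qed.

(** The inverse hyperbolic cosine of the form, by choice; on the sheet the default 0 is never taken
    for want of a solution, by [mform_ge1]. *)
Definition sheet_dist v w : R := xget 0 [set t | 0 <= t /\ cosh t = mform v w].

Lemma sheet_distP v w : on_sheet v -> on_sheet w ->
  0 <= sheet_dist v w /\ cosh (sheet_dist v w) = mform v w.
Proof.
move=> vS wS; have h := mform_ge1 vS wS.
rewrite /sheet_dist; set c := mform _ _ in h *.
have c0 : 0 <= c ^+ 2 - 1 by rewrite expr2; nra.
have [] := @cosh_sinh_surj c (Num.sqrt (c ^+ 2 - 1)).
- by lra.
- exact: sqrtr_ge0.
- by rewrite -!expr2 sqr_sqrtr //; ring.
by move=> t t0 [ct _]; apply: (@xgetI R 0 [set t | 0 <= t /\ cosh t = c] t).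
Qed.

Lemma sheet_dist_eq v w t : on_sheet v -> on_sheet w ->
  0 <= t -> cosh t = mform v w -> t = sheet_dist v w.
Proof.
move=> vS wS t0 ct; have [d0 cd] := sheet_distP vS wS.
by apply: cosh_inj => //; rewrite ct cd.
Qed.

Lemma sheet_dist_triangle x y z : on_sheet x -> on_sheet y -> on_sheet z ->
  sheet_dist x z <= sheet_dist x y + sheet_dist y z.
Proof.
move=> xS yS zS; have [? ?] := sheet_distP xS yS.
have [? ?] := sheet_distP yS zS; have [? ?] := sheet_distP xS zS.
exact: (@sheet_triangle x y z).
Qed.

Lemma sheet_distC v w : sheet_dist v w = sheet_dist w v.
Proof. by rewrite /sheet_dist mformC. Qed.

Lemma sheet_distxx v : on_sheet v -> sheet_dist v v = 0.
Proof. by move=> vS; rewrite -(@sheet_dist_eq v v 0) // cosh0 (proj2 vS). Qed.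

Lemma vec_dist rho1 phi1 rho2 phi2 t :
  is_hyp_dist rho1 phi1 rho2 phi2 t <->
  t = sheet_dist (vec rho1 phi1) (vec rho2 phi2).
Proof.
rewrite is_hyp_distE.
have [d0 cd] := sheet_distP (vec_sheet rho1 phi1) (vec_sheet rho2 phi2).
split=> [[t0 ct]|->//]; apply: sheet_dist_eq => //; exact: vec_sheet.
Qed.

Lemma vec_dist0 rho phi : 0 <= rho -> sheet_dist (vec 0 0) (vec rho phi) = rho.
Proof.
move=> rho0; apply/esym/vec_dist/is_hyp_distE; split=> //.
by rewrite /mform /= cosh0 sinh0; ring.
Qed.

End Hyperboloid.

(** * The relations evaluated in the superstructure *)

Section Standard.
Variable R : realType.
Local Notation b := (id : superstructure R -> std R).
Implicit Types (a c d e q rho phi : R).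

(** [hyp_point] is the pair of any two individuals and also serves for the graphs on R. The free n
    covers stage 2, needed for graphs, and stage 4, needed by [is_opairE]. *)
Lemma hyp_point_stage n rho phi : stage n.+2 (hyp_point rho phi).
Proof. by apply: opair_stage; exact: stage_ind. Qed.

Lemma hyp_point_inj rho1 phi1 rho2 phi2 :
  hyp_point rho1 phi1 = hyp_point rho2 phi2 -> rho1 = rho2 /\ phi1 = phi2.
Proof. by move=> /opair_inj[h1 h2]; split; apply: ind_inj. Qed.

Lemma smem_hyp_plane x : smem x (hyp_plane R) <->
  exists rho phi, polar rho phi /\ x = hyp_point rho phi.
Proof.
rewrite smem_sep; split=> [[]//|[rho [phi [h ->]]]].
by split; [exact: hyp_point_stage|exists rho, phi].
Qed.

Lemma std_pair x rho phi : pairD b x (ind rho) (ind phi) <-> x = hyp_point rho phi.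
Proof. by apply: is_opairE; exact: stage_ind. Qed.

Lemma std_rel (r : R -> R -> Prop) a c : relD b (rel_graph r) (ind a) (ind c) <-> r a c.
Proof.
split=> [[p /= + /std_pair pE]|rac].
  rewrite pE => /smem_sep[_ [a' [c' [h]]]].
  by move=> /hyp_point_inj[-> ->].
exists (hyp_point a c); last exact/std_pair.
by apply/smem_sep; split; [exact: hyp_point_stage|exists a, c].
Qed.

Lemma std_op (f : R -> R -> R) a c d :
  opD b (op_graph f) (ind a) (ind c) (ind d) <-> d = f a c.
Proof.
have s4 : stage 4 (hyp_point a c) by exact: hyp_point_stage.
split=> [[p /std_pair ->] [t /= tG /(is_opairE _ s4 (stage_ind _ _)) tE]|->].
  move: tG; rewrite tE => /smem_sep[_ [a' [c' /opair_inj[/hyp_point_inj[-> ->]]]]].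
  exact: ind_inj.
exists (hyp_point a c); first exact/std_pair.
exists (opair (hyp_point a c) (ind (f a c))).
  apply/smem_sep; split; last by exists a, c.
  by apply: opair_stage; [exact: hyp_point_stage|exact: stage_ind].
by apply/is_opairE => //; exact: stage_ind.
Qed.

Lemma std_dist rho1 phi1 rho2 phi2 d : polar rho1 phi1 -> polar rho2 phi2 ->
  opD b (hyp_dist_graph R) (hyp_point rho1 phi1) (hyp_point rho2 phi2) (ind d) <->
  d = sheet_dist (vec rho1 phi1) (vec rho2 phi2).
Proof.
move=> P1 P2; rewrite -vec_dist.
have s1 n : stage n.+2 (hyp_point rho1 phi1) by exact: hyp_point_stage.
have s2 n : stage n.+2 (hyp_point rho2 phi2) by exact: hyp_point_stage.
have s4 : stage 4 (opair (hyp_point rho1 phi1) (hyp_point rho2 phi2)).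
  exact: opair_stage.
split.
  move=> [p /(is_opairE _ (s1 2) (s2 2)) ->].
  move=> [t /= tG /(is_opairE _ s4 (stage_ind _ _)) tE].
  move: tG; rewrite tE => /smem_sep[_ [r1 [p1 [r2 [p2 [d' [_ [_ [h]]]]]]]]].
  move=> /opair_inj[/opair_inj[/hyp_point_inj[-> ->] /hyp_point_inj[-> ->]] dE].
  by rewrite (ind_inj dE).
move=> h; exists (opair (hyp_point rho1 phi1) (hyp_point rho2 phi2)).
  exact/is_opairE.
exists (opair (opair (hyp_point rho1 phi1) (hyp_point rho2 phi2)) (ind d)).
  apply/smem_sep; split; last by exists rho1, phi1, rho2, phi2, d.
  by apply: opair_stage => //; exact: stage_ind.
by apply/is_opairE => //; exact: stage_ind.
Qed.

Lemma std_near e rho1 phi1 rho2 phi2 q : polar rho1 phi1 -> polar rho2 phi2 ->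
  nearD b (ind e) (hyp_point rho1 phi1) (hyp_point rho2 phi2) (ind q) <->
  e * sheet_dist (vec rho1 phi1) (vec rho2 phi2) < q.
Proof.
move=> P1 P2; split.
  move=> [_ /smem_Rset[d ->] [/(std_dist _ P1 P2) ->]].
  by move=> [_ /smem_Rset[m ->] [/std_op -> /std_rel]].
move=> h; exists (ind (sheet_dist (vec rho1 phi1) (vec rho2 phi2))).
  by apply/smem_Rset; eexists.
split; first exact/std_dist.
exists (ind (e * sheet_dist (vec rho1 phi1) (vec rho2 phi2))).
  by apply/smem_Rset; eexists.
by split; [exact/std_op|exact/std_rel].
Qed.

Lemma std_in g x y : stage 4 x -> stage 4 y -> inD b g x y <-> smem (opair x y) g.
Proof.
move=> sx sy; split=> [[p _ [/= + /(is_opairE _ sx sy) pE]]|h].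
  by rewrite pE.
exists (opair x y); last by split=> //; exact/is_opairE.
by apply/smem_sep; split=> //; exact: opair_stage.
Qed.

End Standard.

(** Variables are counted outwards: [v0] belongs to the innermost quantifier. *)
Local Notation v0 := (Var _ None).
Local Notation v1 := (Var _ (Some None)).
Local Notation v2 := (Var _ (Some (Some None))).
Local Notation v3 := (Var _ (Some (Some (Some None)))).
Local Notation v4 := (Var _ (Some (Some (Some (Some None))))).
Local Notation v5 := (Var _ (Some (Some (Some (Some (Some None)))))).
Local Notation v6 := (Var _ (Some (Some (Some (Some (Some (Some None))))))).

(** * Transferred facts about *R and the nonstandard plane *)

Section Transfer.
Variables (R : realType) (M : nonstandard_model R).
Local Notation H := (fun x : M => memr x (star M (hyp_plane R))).
Local Notation near := (nearD (star M)).
Local Notation formula := (formula R (superstructure R) void).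

Lemma ztransfer (phi : formula) :
  sat (D := std R) id id (@of_void _) phi ->
  sat (D := M) (star M) (star M) (@of_void _) phi.
Proof. exact: (transfer M phi).1. Qed.

Lemma starR_real r : starR (real M r).
Proof. by apply/star_mem/smem_Rset; exists r. Qed.

(** [fun2_ext] chooses its value with a default; the transferred totality of f shows that there is a
    genuine value to choose. *)
Lemma fun2_extP (f : R -> R -> R) a c (fac := fun2_ext (op_graph f) a c) :
  starR a -> starR c -> starR fac /\ opD (star M) (op_graph f) a c fac.
Proof.
move=> aR cR; pose phi : formula := FAll (entR R) (FAll (entR R)
  (FEx (entR R) (fop (entOp f) v2 v1 v0))).
have h : sat (D := std R) id id (@of_void _) phi.
  rewrite /phi; cbn [sat] => _ /smem_Rset[a' ->] _ /smem_Rset[c' ->].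
  exists (ind (f a' c')); first by apply/smem_Rset; eexists.
  by rewrite sat_op; apply/std_op.
move: (ztransfer h); rewrite /phi; cbn [sat] => /(_ a aR c cR)[d dR].
rewrite sat_op => dE.
by apply: (@xgetI {classic M} (real M 0)
  [set c' | starR c' /\ opD (star M) (op_graph f) a c c'] d).
Qed.

Lemma absM_rel a : starR a ->
  starR (absM a) /\ relD (star M) (abs_graph R) a (absM a).
Proof.
move=> aR; pose phi : formula := FAll (entR R)
  (FEx (entR R) (frelD (entAbs R) v1 v0)).
have h : sat (D := std R) id id (@of_void _) phi.
  rewrite /phi; cbn [sat] => _ /smem_Rset[a' ->].
  exists (ind `|a'|); first by apply/smem_Rset; eexists.
  by rewrite sat_rel; apply/std_rel.
move: (ztransfer h); rewrite /phi; cbn [sat] => /(_ a aR)[d dR].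
rewrite sat_rel => dE.
by apply: (@xgetI {classic M} (real M 0)
  [set c' | starR c' /\ relD (star M) (abs_graph R) a c'] d).
Qed.

Lemma hdistM_op x y : H x -> H y ->
  starR (hdistM x y) /\ opD (star M) (hyp_dist_graph R) x y (hdistM x y).
Proof.
move=> xH yH; pose phi : formula := FAll (entH R) (FAll (entH R)
  (FEx (entR R) (fop (entDist R) v2 v1 v0))).
have h : sat (D := std R) id id (@of_void _) phi.
  rewrite /phi; cbn [sat].
  move=> _ /smem_hyp_plane[r1 [p1 [P1 ->]]] _ /smem_hyp_plane[r2 [p2 [P2 ->]]].
  exists (ind (sheet_dist (vec r1 p1) (vec r2 p2))).
    by apply/smem_Rset; eexists.
  by rewrite sat_op; apply/std_dist.
move: (ztransfer h); rewrite /phi; cbn [sat] => /(_ x xH y yH)[d dR].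
rewrite sat_op => dE.
by apply: (@xgetI {classic M} (real M 0)
  [set c' | starR c' /\ opD (star M) (hyp_dist_graph R) x y c'] d).
Qed.

Lemma coordinates x : H x ->
  exists rho phi, [/\ starR rho, starR phi & pairing x rho phi].
Proof.
move=> xH; pose phi : formula := FAll (entH R)
  (FEx (entR R) (FEx (entR R) (fopair v2 v1 v0))).
have h : sat (D := std R) id id (@of_void _) phi.
  rewrite /phi; cbn [sat] => _ /smem_hyp_plane[r [p [_ ->]]].
  exists (ind r); first by apply/smem_Rset; eexists.
  exists (ind p); first by apply/smem_Rset; eexists.
  by rewrite sat_opair; apply/std_pair.
move: (ztransfer h); rewrite /phi; cbn [sat] => /(_ x xH)[r rR [p pR]].
by rewrite sat_opair => hx; exists r, p.
Qed.

Section Positive.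
Variable e : M.
Hypotheses (eR : starR e) (e0 : ltM (real M 0) e).

Lemma near_sym x y q : H x -> H y ->
  near e x y (real M q) -> near e y x (real M q).
Proof.
move=> xH yH.
pose phi : formula := FAll (entR R) (FAll (entH R) (FAll (entH R)
  (FImp (fnear v2 v1 v0 (Cst _ (ind q))) (fnear v2 v0 v1 (Cst _ (ind q)))))).
have h : sat (D := std R) id id (@of_void _) phi.
  rewrite /phi; cbn [sat].
  move=> _ /smem_Rset[a ->] _ /smem_hyp_plane[r1 [p1 [P1 ->]]].
  move=> _ /smem_hyp_plane[r2 [p2 [P2 ->]]].
  by rewrite !sat_near => /(std_near _ _ P1 P2) nr; apply/std_near; rewrite // sheet_distC.
move: (ztransfer h); rewrite /phi; cbn [sat] => /(_ e eR x xH y yH).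
by rewrite !sat_near.
Qed.

Lemma near_refl x q : H x -> 0 < q -> near e x x (real M q).
Proof.
move=> xH q0.
pose phi : formula := FAll (entR R) (FAll (entH R)
  (fnear v1 v0 v0 (Cst _ (ind q)))).
have h : sat (D := std R) id id (@of_void _) phi.
  rewrite /phi; cbn [sat].
  move=> _ /smem_Rset[a ->] _ /smem_hyp_plane[r1 [p1 [P1 ->]]].
  by rewrite !sat_near; apply/std_near; rewrite // sheet_distxx ?mulr0 //; exact: vec_sheet.
move: (ztransfer h); rewrite /phi; cbn [sat] => /(_ e eR x xH).
by rewrite !sat_near.
Qed.

Lemma near_gt0 x y q : H x -> H y -> near e x y (real M q) -> 0 < q.
Proof.
(* The sign of q is decided in R, outside the sentence, where q is a constant. *)
move=> xH yH nxy; rewrite ltNge; apply/negP => q0; move: nxy.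
pose phi : formula := FAll (entR R) (FAll (entH R) (FAll (entH R)
  (FImp (frelD (entLt R) (Cst _ (ind 0)) v2)
    (FNot (fnear v2 v1 v0 (Cst _ (ind q))))))).
have h : sat (D := std R) id id (@of_void _) phi.
  rewrite /phi; cbn [sat].
  move=> _ /smem_Rset[a ->] _ /smem_hyp_plane[r1 [p1 [P1 ->]]].
  move=> _ /smem_hyp_plane[r2 [p2 [P2 ->]]].
  rewrite sat_rel sat_near => /std_rel a0 /(std_near _ _ P1 P2).
  have [d0 _] := sheet_distP (vec_sheet r1 p1) (vec_sheet r2 p2).
  by have := mulr_ge0 (ltW a0) d0; lra.
move: (ztransfer h); rewrite /phi; cbn [sat] => /(_ e eR x xH y yH).
by rewrite sat_near sat_rel => /(_ e0).
Qed.

Lemma near_triangle x y z q s : H x -> H y -> H z ->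
  near e x y (real M q) -> near e y z (real M s) -> near e x z (real M (q + s)).
Proof.
move=> xH yH zH.
pose phi : formula := FAll (entR R) (FAll (entH R) (FAll (entH R) (FAll (entH R)
  (FImp (frelD (entLt R) (Cst _ (ind 0)) v3)
  (FImp (fnear v3 v2 v1 (Cst _ (ind q))) (FImp (fnear v3 v1 v0 (Cst _ (ind s)))
     (fnear v3 v2 v0 (Cst _ (ind (q + s)))))))))).
have h : sat (D := std R) id id (@of_void _) phi.
  rewrite /phi; cbn [sat].
  move=> _ /smem_Rset[a ->] _ /smem_hyp_plane[r1 [p1 [P1 ->]]].
  move=> _ /smem_hyp_plane[r2 [p2 [P2 ->]]] _ /smem_hyp_plane[r3 [p3 [P3 ->]]].
  rewrite sat_rel !sat_near => /std_rel a0.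
  move=> /(std_near _ _ P1 P2) h1 /(std_near _ _ P2 P3) h2; apply/std_near => //.
  have := @sheet_dist_triangle R (vec r1 p1) (vec r2 p2) (vec r3 p3).
  move=> /(_ (vec_sheet _ _) (vec_sheet _ _) (vec_sheet _ _)).
  by rewrite -(ler_pM2l a0); lra.
move: (ztransfer h); rewrite /phi; cbn [sat] => /(_ e eR x xH y yH z zH).
by rewrite sat_rel !sat_near; apply.
Qed.

(** Here t is |e d(x, y) - r|. Failure of [nearD] yields only a non-strict lower bound, so the
    converse starts from k / 2 to recover the strict one; this is harmless as k will run over all
    positive reals. *)
Lemma std_part_near x y r k d m s t : H x -> H y ->
  starR d -> starR m -> starR s -> starR t ->
  opD (star M) (hyp_dist_graph R) x y d -> opD (star M) (op_graph *%R) e d m ->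
  opD (star M) (op_graph (fun a b => a - b)) m (real M r) s -> relD (star M) (abs_graph R) s t ->
  (ltM t (real M k) ->
     near e x y (real M (r + k)) /\ ~ near e x y (real M (r - k))) /\
  (near e x y (real M (r + k / 2)) /\ ~ near e x y (real M (r - k / 2)) ->
     ltM t (real M k)).
Proof.
move=> xH yH dR mR sR tR.
pose phi : formula := FAll (entR R) (FAll (entH R) (FAll (entH R)
  (FAll (entR R) (FAll (entR R) (FAll (entR R) (FAll (entR R)
  (FImp (fop (entDist R) v5 v4 v3) (FImp (fop (entOp *%R) v6 v3 v2)
  (FImp (fop (entOp (fun a b => a - b)) v2 (Cst _ (ind r)) v1) (FImp (frelD (entAbs R) v1 v0)
  (FAnd (FImp (frelD (entLt R) v0 (Cst _ (ind k)))
          (FAnd (fnear v6 v5 v4 (Cst _ (ind (r + k))))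
                (FNot (fnear v6 v5 v4 (Cst _ (ind (r - k)))))))
        (FImp (FAnd (fnear v6 v5 v4 (Cst _ (ind (r + k / 2))))
                (FNot (fnear v6 v5 v4 (Cst _ (ind (r - k / 2))))))
          (frelD (entLt R) v0 (Cst _ (ind k))))))))))))))).
have h : sat (D := std R) id id (@of_void _) phi.
  rewrite /phi; cbn [sat].
  move=> _ /smem_Rset[a ->] _ /smem_hyp_plane[r1 [p1 [P1 ->]]].
  move=> _ /smem_hyp_plane[r2 [p2 [P2 ->]]].
  move=> _ /smem_Rset[d' ->] _ /smem_Rset[m' ->] _ /smem_Rset[s' ->] _ /smem_Rset[t' ->].
  rewrite !sat_op !sat_rel !sat_near.
  move=> /(std_dist _ P1 P2) dE /std_op mE /std_op sE /std_rel tE.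
  move: mE; rewrite dE => mE; subst; split.
    move=> /std_rel; rewrite ltr_norml => /andP[h1 h2].
    by split; [apply/std_near => //; lra|move=> /(std_near _ _ P1 P2); lra].
  move=> [/(std_near _ _ P1 P2) h1 h2]; apply/std_rel.
  have {}h2 : r - k / 2 <= a * sheet_dist (vec r1 p1) (vec r2 p2).
    by rewrite leNgt; apply/negP => h3; apply: h2; apply/std_near.
  by rewrite ltr_norml; apply/andP; split; lra.
move: (ztransfer h); rewrite /phi; cbn [sat].
move=> /(_ e eR x xH y yH d dR m mR s sR t tR).
by rewrite !sat_op !sat_rel !sat_near.
Qed.

Lemma abs_dist_near x y k d m t : H x -> H y -> starR d -> starR m -> starR t ->
  opD (star M) (hyp_dist_graph R) x y d -> opD (star M) (op_graph *%R) e d m ->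
  relD (star M) (abs_graph R) m t ->
  ltM t (real M k) <-> near e x y (real M k).
Proof.
move=> xH yH dR mR tR.
pose phi : formula := FAll (entR R) (FAll (entH R) (FAll (entH R)
  (FAll (entR R) (FAll (entR R) (FAll (entR R)
  (FImp (frelD (entLt R) (Cst _ (ind 0)) v5)
  (FImp (fop (entDist R) v4 v3 v2) (FImp (fop (entOp *%R) v5 v2 v1)
  (FImp (frelD (entAbs R) v1 v0)
  (fiff (frelD (entLt R) v0 (Cst _ (ind k))) (fnear v5 v4 v3 (Cst _ (ind k))))))))))))).
have h : sat (D := std R) id id (@of_void _) phi.
  rewrite /phi; cbn [sat fiff].
  move=> _ /smem_Rset[a ->] _ /smem_hyp_plane[r1 [p1 [P1 ->]]].
  move=> _ /smem_hyp_plane[r2 [p2 [P2 ->]]].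
  move=> _ /smem_Rset[d' ->] _ /smem_Rset[m' ->] _ /smem_Rset[t' ->].
  rewrite !sat_op !sat_rel !sat_near.
  move=> /std_rel a0 /(std_dist _ P1 P2) dE /std_op mE /std_rel tE.
  move: mE; rewrite dE => mE; subst.
  have [d0 _] := sheet_distP (vec_sheet r1 p1) (vec_sheet r2 p2).
  have ad0 := mulr_ge0 (ltW a0) d0; rewrite ger0_norm //.
  by split=> [/std_rel h|/(std_near _ _ P1 P2) h]; [apply/std_near|apply/std_rel].
move: (ztransfer h); rewrite /phi; cbn [sat fiff].
move=> /(_ e eR x xH y yH d dR m mR t tR).
by rewrite !sat_op !sat_rel !sat_near; apply.
Qed.

Definition origin : M := star M (hyp_point 0 0).

Lemma polar0 : polar (0 : R) 0.
Proof. by split=> //; split=> //; rewrite lexx mulr_gt0 ?pi_gt0. Qed.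

Lemma originH : H origin.
Proof.
by apply/star_mem/smem_hyp_plane; exists 0, 0; split=> //; exact: polar0.
Qed.

(** The radius is the distance to the origin, so finiteness of e rho becomes a statement about
    [nearD], to which the triangle inequality applies. *)
Lemma abs_radius_near x rho phi k m t : H x ->
  starR rho -> starR phi -> starR m -> starR t -> pairing x rho phi ->
  opD (star M) (op_graph *%R) e rho m -> relD (star M) (abs_graph R) m t ->
  ltM t (real M k) <-> near e origin x (real M k).
Proof.
move=> xH rR pR mR tR.
pose psi : formula := FAll (entR R) (FAll (entH R) (FAll (entR R)
  (FAll (entR R) (FAll (entR R) (FAll (entR R)
  (FImp (frelD (entLt R) (Cst _ (ind 0)) v5)
  (FImp (fopair v4 v3 v2) (FImp (fop (entOp *%R) v5 v3 v1)
  (FImp (frelD (entAbs R) v1 v0)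
  (fiff (frelD (entLt R) v0 (Cst _ (ind k)))
        (fnear v5 (Cst _ (hyp_point 0 0)) v4 (Cst _ (ind k))))))))))))).
have h : sat (D := std R) id id (@of_void _) psi.
  rewrite /psi; cbn [sat fiff].
  move=> _ /smem_Rset[a ->] _ /smem_hyp_plane[r1 [p1 [P1 ->]]].
  move=> _ /smem_Rset[r ->] _ /smem_Rset[p ->] _ /smem_Rset[m' ->] _ /smem_Rset[t' ->].
  rewrite !sat_op !sat_rel !sat_near !sat_opair.
  move=> /std_rel a0 /std_pair/hyp_point_inj[? ?] /std_op mE /std_rel tE; subst.
  have [r0 _] := P1; rewrite ger0_norm ?mulr_ge0 ?(ltW a0) //.
  split=> [/std_rel h|/(std_near _ _ polar0 P1)]; last first.
    by rewrite vec_dist0 // => h; apply/std_rel.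
  by apply/std_near => //; [exact: polar0|rewrite vec_dist0].
move: (ztransfer h); rewrite /psi; cbn [sat fiff].
move=> /(_ e eR x xH rho rR phi pR m mR t tR).
by rewrite !sat_op !sat_rel !sat_near sat_opair; apply.
Qed.

End Positive.

(** One g must serve for all q, so q is quantified inside the sentence, after g, instead of being a
    constant; e is quantified too, since it will be the nonstandard eps. *)
Lemma half_turn_ex x y : H x -> H y -> exists g : M, [/\ inD (star M) g x y,
  forall z, H z -> exists2 w, H w & inD (star M) g z w,
  forall w, H w -> exists2 z, H z & inD (star M) g z w &
  forall e q z w z' w', starR e -> H z -> H w -> H z' -> H w' ->
    inD (star M) g z w -> inD (star M) g z' w' ->
    near e z z' (real M q) <-> near e w w' (real M q)].
Proof.
move=> xH yH.
pose phi : formula := FAll (entH R) (FAll (entH R) (FEx (entS6 R)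
  (FAnd (fin v0 v2 v1) (FAnd
     (FAll (entH R) (FEx (entH R) (fin v2 v1 v0)))
  (FAnd
     (FAll (entH R) (FEx (entH R) (fin v2 v0 v1)))
     (FAll (entR R) (FAll (entR R) (FAll (entH R) (FAll (entH R)
       (FAll (entH R) (FAll (entH R)
       (FImp (fin v6 v3 v2) (FImp (fin v6 v1 v0)
         (fiff (fnear v5 v3 v1 v4) (fnear v5 v2 v0 v4))))))))))))))).
have h : sat (D := std R) id id (@of_void _) phi.
  rewrite /phi; cbn [sat fiff].
  move=> _ /smem_hyp_plane[r1 [p1 [P1 ->]]] _ /smem_hyp_plane[r2 [p2 [P2 ->]]].
  set T := half_turn (vec r1 p1) (vec r2 p2).
  have S1 := vec_sheet r1 p1; have S2 := vec_sheet r2 p2.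
  (* Points are in S_2 and pairs of points in S_4, so the graph is a subset of S_4. *)
  pose gr := [set t : superstructure R | exists r p s q, [/\ polar r p, polar s q,
    vec s q = T (vec r p) & t = opair (hyp_point r p) (hyp_point s q)]].
  have grE z w : smem (opair z w) (sep 4 gr) <-> exists r p s q,
     [/\ polar r p, polar s q, vec s q = T (vec r p), z = hyp_point r p
       & w = hyp_point s q].
    rewrite smem_sep; split.
      by move=> [_ [r [p [s [q [? ? ? /opair_inj[? ?]]]]]]]; exists r, p, s, q.
    move=> [r [p [s [q [? ? ? -> ->]]]]]; split; last by exists r, p, s, q.
    by apply: opair_stage; exact: hyp_point_stage.
  exists (sep 4 gr).
    by apply/smem_sep; split=> //; apply: stage_sub; exact: sep_stage.
  have fwd r p : polar r p -> exists2 w, smem w (hyp_plane R) &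
      smem (opair (hyp_point r p) w) (sep 4 gr).
    move=> P; have [s [q [Q sq]]] := vec_surj (half_turn_sheet S1 S2 (vec_sheet r p)).
    exists (hyp_point s q); first by apply/smem_hyp_plane; exists s, q.
    by apply/grE; exists r, p, s, q.
  split; [|split; [|split]].
  - rewrite sat_in /=; apply/std_in; try exact: hyp_point_stage.
    apply/grE; exists r1, p1, r2, p2; split=> //.
    by rewrite /T half_turn_swap.
  - move=> _ /smem_hyp_plane[r [p [P ->]]]; have [w wH wE] := fwd r p P.
    exists w => //; rewrite sat_in /=; apply/std_in => //; first exact: hyp_point_stage.
    by move: wH => /smem_hyp_plane[? [? [_ ->]]]; exact: hyp_point_stage.
  - move=> _ /smem_hyp_plane[r [p [P ->]]].
    (* The half-turn being an involution, the image of a point is also a preimage of it. *)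
    have [s [q [Q sq]]] := vec_surj (half_turn_sheet S1 S2 (vec_sheet r p)).
    exists (hyp_point s q); first by apply/smem_hyp_plane; exists s, q.
    rewrite sat_in /=; apply/std_in; try exact: hyp_point_stage.
    apply/grE; exists s, q, r, p; split=> //.
    by rewrite sq /T half_turnK.
  move=> _ /smem_Rset[a ->] _ /smem_Rset[k ->].
  move=> _ /smem_hyp_plane[a1 [b1 [Q1 ->]]] _ /smem_hyp_plane[a2 [b2 [Q2 ->]]].
  move=> _ /smem_hyp_plane[a3 [b3 [Q3 ->]]] _ /smem_hyp_plane[a4 [b4 [Q4 ->]]].
  rewrite !sat_in !sat_near /=.
  have std_in' r p s q :
      inD (id : superstructure R -> std R) (sep 4 gr)
        (hyp_point r p) (hyp_point s q) -> vec s q = T (vec r p).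
    move=> /(std_in _ (hyp_point_stage _ _ _) (hyp_point_stage _ _ _))/grE.
    by move=> [? [? [? [? [_ _ ? /hyp_point_inj[-> ->] /hyp_point_inj[-> ->]]]]]].
  move=> /std_in' e12 /std_in' e34.
  have ed : sheet_dist (vec a2 b2) (vec a4 b4) = sheet_dist (vec a1 b1) (vec a3 b3).
    by rewrite /sheet_dist e12 e34 half_turn_form.
  split=> [/(std_near _ _ Q1 Q3) n|/(std_near _ _ Q2 Q4) n];
    by apply/std_near => //; rewrite ?ed // -ed.
move: (ztransfer h); rewrite /phi; cbn [sat fiff].
move=> /(_ x xH y yH)[g _ [gxy [gl [gr gn]]]]; exists g; split.
- by move: gxy; rewrite sat_in.
- by move=> z /gl[w wH]; rewrite sat_in; exists w.
- by move=> w /gr[z zH]; rewrite sat_in; exists z.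
move=> e q z w z' w' eR zH wH zH' wH'.
move: (gn e eR (real M q) (starR_real q) z zH w wH z' zH' w' wH').
by rewrite !sat_in !sat_near.
Qed.
End Transfer.

(** * Standard parts of distances, the metric and the induced isometry *)

Section Asymptotic.
Variables (R : realType) (M : nonstandard_model R) (eps : M).
Hypothesis heps : pos_infinitesimal eps.

Local Notation H := (fun x : M => memr x (star M (hyp_plane R))).
Local Notation B := (fun x y (q : R) => nearD (star M) eps x y (real M q)).
Local Notation O := (origin M).

Let eR : starR eps := heps.1.1.
Let e0 : ltM (real M 0) eps := heps.2.

Lemma finite_partP x : finite_part eps x <-> H x /\ exists q, B O x q.
Proof.
split=> [[xH [rho [phi [rR pR xE [mR [q qE]]]]]]|[xH [q qE]]].
  split=> //; exists q.
  have [_ mE] := fun2_extP *%R eR rR; have [tR tE] := absM_rel mR.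
  exact/(abs_radius_near eR e0 q xH rR pR mR tR xE mE tE).
have [rho [phi [rR pR xE]]] := coordinates xH.
have [mR mE] := fun2_extP *%R eR rR; have [tR tE] := absM_rel mR.
split=> //; exists rho, phi; split=> //; split=> //; exists q.
exact/(abs_radius_near eR e0 q xH rR pR mR tR xE mE tE).
Qed.

Lemma inf_nearP x y : H x -> H y ->
  inf_near eps x y <-> forall k, 0 < k -> B x y k.
Proof.
move=> xH yH; have [dR dE] := hdistM_op xH yH.
have [mR mE] := fun2_extP *%R eR dR; have [tR tE] := absM_rel mR.
have h k := abs_dist_near eR e0 k xH yH dR mR tR dE mE tE.
by split=> [[_ hk] k /hk/h|hk] //; split=> // k /hk/h.
Qed.

(* [std_dist_lim x y r] says that [r] is the standard part of eps * d(x, y). *)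
Definition std_dist_lim (x y : M) (r : R) : Prop :=
  forall k, 0 < k -> B x y (r + k) /\ ~ B x y (r - k).

Local Notation lim := std_dist_lim.

Lemma infinitesimal_subP x y r : H x -> H y ->
  infinitesimal (subM (scaled_dist eps x y) (real M r)) <-> lim x y r.
Proof.
move=> xH yH; have [dR dE] := hdistM_op xH yH.
have [mR mE] := fun2_extP *%R eR dR.
have [sR sE] := fun2_extP (fun a b => a - b) mR (starR_real M r).
have [tR tE] := absM_rel sR.
have h k := std_part_near eR k xH yH dR mR sR tR dE mE sE tE.
split=> [[_ hk] k k0|hk]; first exact: (h k).1 (hk k k0).
split=> // k k0; apply: (h k).2.
by apply: hk; rewrite divr_gt0.
Qed.

(** Triangle inequality through y, which is within s - q of itself. *)
Lemma near_le x y q s : H x -> H y -> q <= s -> B x y q -> B x y s.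
Proof.
move=> xH yH; rewrite le_eqVlt => /predU1P[->//|qs] Bq.
rewrite (_ : s = q + (s - q)); last by ring.
by apply: near_triangle Bq _ => //; apply: near_refl; rewrite // subr_gt0.
Qed.

Lemma lim_ge0 x y r : H x -> H y -> lim x y r -> 0 <= r.
Proof.
move=> xH yH l; rewrite leNgt; apply/negP => r0.
(* With k = - r the upper bound r + k is 0, which no distance is below. *)
have [|+ _] := l (- r); first lra.
by rewrite subrr => /(near_gt0 eR e0 xH yH); rewrite ltxx.
Qed.

Lemma lim_triangle x y z r s t : H x -> H y -> H z ->
  lim x y r -> lim y z s -> lim x z t -> t <= r + s.
Proof.
move=> xH yH zH lr ls lt; rewrite leNgt; apply/negP => h.
(* A third, because then (r + k) + (s + k) = t - k exactly. *)
have k0 : 0 < (t - (r + s)) / 3 by lra.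
have [B1 _] := lr _ k0; have [B2 _] := ls _ k0; have [_] := lt _ k0; apply.
apply: near_le (near_triangle eR e0 xH yH zH B1 B2) => //; lra.
Qed.

Lemma lim_sym x y r : H x -> H y -> lim x y r -> lim y x r.
Proof.
move=> xH yH l k /l[B1 B2]; split; first exact: near_sym.
by move=> /(near_sym eR yH xH).
Qed.

Lemma lim0P x y : H x -> H y -> lim x y 0 <-> inf_near eps x y.
Proof.
move=> xH yH; rewrite inf_nearP //; split=> l k k0.
  by have [] := l k k0; rewrite add0r.
rewrite add0r; split; first exact: l.
by move=> /(near_gt0 eR e0 xH yH); lra.
Qed.

Lemma lim_refl x : H x -> lim x x 0.
Proof. by move=> xH; apply/lim0P => //; apply/inf_nearP => // k; exact: near_refl. Qed.

(** Both end points are moved by infinitely small amounts, one after the other. Exchanging the two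
    pairs gives equality, so the limit depends only on the classes. *)
Lemma lim_congr x x' y y' r s : H x -> H x' -> H y -> H y' ->
  lim x x' 0 -> lim y y' 0 -> lim x y r -> lim x' y' s -> s <= r.
Proof.
move=> xH xH' yH yH' lx ly lr ls.
have nlx := lim_sym xH xH' lx.
have n1 k : 0 < k -> B x' y (r + k).
  move=> k0; have k2 : 0 < k / 2 by lra.
  have [B1 _] := nlx _ k2; have [B2 _] := lr _ k2.
  by apply: near_le (near_triangle eR e0 xH' xH yH B1 B2) => //; lra.
rewrite leNgt; apply/negP => h.
have k0 : 0 < (s - r) / 3 by lra.
have [B2 _] := ly _ k0; have [_] := ls _ k0; apply.
by apply: near_le (near_triangle eR e0 xH' yH yH' (n1 _ k0) B2) => //; lra.
Qed.

Lemma lim_unique x y r s : H x -> H y -> lim x y r -> lim x y s -> r = s.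
Proof.
move=> xH yH lr ls; have [rx ry] := (lim_refl xH, lim_refl yH).
apply/eqP; rewrite eq_le.
by rewrite (lim_congr xH xH yH yH rx ry ls lr) (lim_congr xH xH yH yH rx ry lr ls).
Qed.

Local Notation Y := (finite_part eps).

Lemma finite_partH x : Y x -> H x. Proof. by case. Qed.

(** Completeness of R: the standard bounds q of eps d(x, y) are positive, there is one by the
    triangle inequality through the origin, and their infimum is the standard part. *)
Lemma lim_ex x y : Y x -> Y y -> exists r, lim x y r.
Proof.
move=> /finite_partP[xH [q Bq]] /finite_partP[yH [s Bs]].
have Bxo := near_sym eR (originH M) xH Bq.
have Bxy := near_triangle eR e0 xH (originH M) yH Bxo Bs.
pose E := [set q | B x y q].
have hE : has_inf E.
  split; first by exists (q + s).
  by exists 0 => r /(near_gt0 eR e0 xH yH)/ltW.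
exists (inf E) => k k0; split.
  have [r Er rk] := inf_adherent k0 hE.
  by apply: near_le (ltW rk) Er.
by move=> /(ge_inf hE.2); lra.
Qed.

Lemma lim_st x y : Y x -> Y y -> lim x y (st (scaled_dist eps x y)).
Proof.
move=> xY yY; have [r rE] := lim_ex xY yY.
have [xH yH] := (finite_partH xY, finite_partH yY).
apply/infinitesimal_subP => //.
apply: (@xgetI R 0 [set r | infinitesimal (subM (scaled_dist eps x y) (real M r))] r).
exact/infinitesimal_subP.
Qed.

Local Notation space := (asymptotic_space eps).
Implicit Types P Q T : space.

Lemma class_inj P Q : sval P = sval Q -> P = Q.
Proof.
case: P Q => [C hC] [D hD] /= e; subst D; congr exist; exact: Prop_irrelevance.
Qed.

Lemma classP P : exists2 p, Y p & forall y, sval P y <-> Y y /\ inf_near eps p y.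
Proof. by case: P => C [p pY CE]; exists p => // y /=; rewrite CE. Qed.

Lemma class_finite P x : sval P x -> Y x.
Proof. by have [p _ PE] := classP P => /PE[]. Qed.

Lemma class_lim P x y : sval P x -> sval P y -> lim x y 0.
Proof.
have [p pY PE] := classP P; move=> /PE[xY xp] /PE[yY yp].
have [[pH xH] yH] := (finite_partH pY, finite_partH xY, finite_partH yY).
move: xp yp => /(lim0P pH xH) xp /(lim0P pH yH) yp.
have [r lr] := lim_ex xY yY.
have r0 := lim_ge0 xH yH lr.
have := lim_triangle xH pH yH (lim_sym pH xH xp) yp lr.
by rewrite addr0 => r0'; have -> : 0 = r by lra.
Qed.

Lemma class_ex P : exists x, sval P x.
Proof.
have [p pY PE] := classP P; exists p; apply/PE; split=> //.
have pH := finite_partH pY; apply/lim0P => //; exact: lim_refl.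
Qed.

Definition class_of x (xY : Y x) : space :=
  exist _ [set y | Y y /\ inf_near eps x y] (ex_intro2 _ _ x xY erefl).

Lemma class_ofP x (xY : Y x) : sval (class_of xY) x.
Proof. by have xH := finite_partH xY; split=> //; apply/lim0P => //; exact: lim_refl. Qed.

Local Notation dist := (@asymptotic_dist R M eps).

(** [asymptotic_dist] is computed from some chosen representatives; [lim_congr], used in both
    directions, carries the value over to x and y. *)
Lemma dist_lim P Q x y : sval P x -> sval Q y -> lim x y (dist P Q).
Proof.
move=> Px Qy; have [xY yY] := (class_finite Px, class_finite Qy).
have [r lr] := lim_ex xY yY.
suff -> : dist P Q = r by [].
have [x' [y' [Px' Qy' ->]]] : [set r | exists x y,
    [/\ sval P x, sval Q y & r = st (scaled_dist eps x y)]] (dist P Q).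
  by apply: xgetPex; exists (st (scaled_dist eps x y)), x, y.
have [xY' yY'] := (class_finite Px', class_finite Qy').
have [xH yH] := (finite_partH xY, finite_partH yY).
have [xH' yH'] := (finite_partH xY', finite_partH yY').
have lr' := lim_st xY' yY'.
have [cx cx'] := (class_lim Px Px', class_lim Px' Px).
have [cy cy'] := (class_lim Qy Qy', class_lim Qy' Qy).
apply/eqP; rewrite eq_le (lim_congr xH xH' yH yH' cx cy lr lr').
exact: lim_congr xH' xH yH' yH cx' cy' lr' lr.
Qed.

Lemma class_sub P Q x y : sval P x -> sval Q y -> lim x y 0 ->
  sval P `<=` sval Q.
Proof.
move=> Px Qy lxy z Pz.
have [xH zH] := (finite_partH (class_finite Px), finite_partH (class_finite Pz)).
have lxz := class_lim Px Pz; have zY := class_finite Pz.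
have [q qY QE] := classP Q; have [yY qy] := (QE y).1 Qy; apply/QE; split=> //.
have [yH qH] := (finite_partH yY, finite_partH qY).
move: qy => /(lim0P qH yH) qy; apply/lim0P => //.
have [s ls] := lim_ex yY zY; have [r lr] := lim_ex qY zY.
have := lim_triangle yH xH zH (lim_sym xH yH lxy) lxz ls.
have := lim_triangle qH yH zH qy ls lr.
have := lim_ge0 qH zH lr; have := lim_ge0 yH zH ls => ? ? ? ?.
by have -> : 0 = r by lra.
Qed.

Lemma dist_metric : is_metric dist.
Proof.
split=> [P Q|P Q|P Q|P Q T].
- have [[x Px] [y Qy]] := (class_ex P, class_ex Q).
  exact: lim_ge0 (finite_partH (class_finite Px)) (finite_partH (class_finite Qy))
    (dist_lim Px Qy).
- have [[x Px] [y Qy]] := (class_ex P, class_ex Q).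
  have [xH yH] := (finite_partH (class_finite Px), finite_partH (class_finite Qy)).
  have l := dist_lim Px Qy; split=> [d0|PQ]; last first.
    by rewrite -PQ in Qy l *; exact: lim_unique xH yH l (class_lim Px Qy).
  rewrite d0 in l; have l' := lim_sym xH yH l.
  apply: class_inj; apply/seteqP; split.
    exact: class_sub Px Qy l.
  exact: class_sub Qy Px l'.
- have [[x Px] [y Qy]] := (class_ex P, class_ex Q).
  have [xH yH] := (finite_partH (class_finite Px), finite_partH (class_finite Qy)).
  apply: (lim_unique xH yH (dist_lim Px Qy)).
  exact: lim_sym (dist_lim Qy Px).
have [[[x Px] [y Qy]] [z Tz]] := (class_ex P, class_ex Q, class_ex T).
have [xH yH] := (finite_partH (class_finite Px), finite_partH (class_finite Qy)).
have zH := finite_partH (class_finite Tz).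
exact: lim_triangle xH yH zH (dist_lim Px Qy) (dist_lim Qy Tz) (dist_lim Px Tz).
Qed.

Lemma dist_transitive P Q : exists2 f, is_isometry dist f & f P = Q.
Proof.
have [[x Px] [y Qy]] := (class_ex P, class_ex Q).
have [xY yY] := (class_finite Px, class_finite Qy).
have [xH yH] := (finite_partH xY, finite_partH yY).
have [g [gxy gl gr gnear]] := half_turn_ex xH yH.
(* d(O, w) <= d(O, v) + d(v, w), where d(v, w) is bounded by d(u, z) <= d(u, O) + d(O, z). It is
   used with (u, v) = (x, y) for images and with (y, x) for preimages. *)
have far u v z w : Y u -> Y v -> Y z -> H w -> (forall q, B u z q -> B v w q) -> Y w.
  move=> /finite_partP[uH [a Ba]] /finite_partP[vH [c Bc]].
  move=> /finite_partP[zH [d Bd]] wH h; apply/finite_partP; split=> //.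
  have Bu := near_sym eR (originH M) uH Ba.
  have /h Bw := near_triangle eR e0 uH (originH M) zH Bu Bd.
  by exists (c + (a + d)); exact (near_triangle eR e0 (originH M) vH wH Bc Bw).
have /choice[f fP] : forall C : space, exists D : space, exists z w,
    [/\ sval C z, sval D w & inD (star M) g z w].
  move=> C; have [z Cz] := class_ex C; have zY := class_finite Cz.
  have zH := finite_partH zY; have [w wH zw] := gl _ zH.
  have wY : Y w.
    apply: (far x y z) => // q; exact: (gnear eps q x y z w eR xH yH zH wH gxy zw).1.
  by exists (class_of wY), z, w; split=> //; exact: class_ofP.
have /choice[h hP] : forall D : space, exists C : space, exists z w,
    [/\ sval C z, sval D w & inD (star M) g z w].
  move=> D; have [w Dw] := class_ex D; have wY := class_finite Dw.
  have wH := finite_partH wY; have [z zH zw] := gr _ wH.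
  have zY : Y z.
    apply: (far y x w) => // q; exact: (gnear eps q x y z w eR xH yH zH wH gxy zw).2.
  by exists (class_of zY), z, w; split=> //; exact: class_ofP.
(* Stated for classes related by g through any representatives, this gives at once that f preserves
   distances, that f and h are mutually inverse and that f P = Q. *)
have iso C D C' D' : (exists z w, [/\ sval C z, sval D w & inD (star M) g z w]) ->
    (exists z w, [/\ sval C' z, sval D' w & inD (star M) g z w]) ->
    dist D D' = dist C C'.
  move=> [z [w [Cz Dw zw]]] [z' [w' [Cz' Dw' zw']]].
  have [zH wH] := (finite_partH (class_finite Cz), finite_partH (class_finite Dw)).
  have [zH' wH'] := (finite_partH (class_finite Cz'), finite_partH (class_finite Dw')).
  apply: (lim_unique wH wH' (dist_lim Dw Dw')) => k /(dist_lim Cz Cz')[B1 B2].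
  by split=> [|/(gnear eps _ z w z' w' eR zH wH zH' wH' zw zw')//];
    apply/(gnear eps _ z w z' w' eR zH wH zH' wH' zw zw').
have d0 := metric_eq0 dist_metric; have dxx C := (d0 C C).2 erefl.
(* Both f P and Q are related to P, the latter by x and y, so their distance is that of P to
   itself. *)
exists f; last by apply/d0; rewrite (iso P _ P) ?dxx //; exists x, y.
split; last by move=> C D; exact: iso.
exists h => C; apply/d0.
  by rewrite -(iso _ _ _ _ (hP (f C)) (fP C)) dxx.
by rewrite (iso _ _ _ _ (fP (h C)) (hP C)) dxx.
Qed.

End Asymptotic.

Theorem theorem6p1 (R : realType) (M : nonstandard_model R) (eps : M)
    (hM : saturated M) (heps : pos_infinitesimal eps) :
  homogeneous_metric_space (@asymptotic_dist R M eps).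
Proof. by split; [exact: dist_metric|exact: dist_transitive]. Qed.
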